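(* Let $r,k,l\in\mathbb Z$, $0\le k\le r$, and $1\le l\le k+2$. Let the value $\widetilde U(t_{n-1}^-)\in\mathbb R^d$ be given. Then $\widetilde U\in P_{r+1}(I_n,\mathbb R^d)$ solves the local problem of $Q^r_k\text{-}\mathbf{VTD}^{r+1}_l$ on $I_n$ if and only if $\widetilde U$ solves (with the same given value at $t_{n-1}$) the local collocation problem with respect to the quadrature points of $Q^r_k$, namely $\widetilde U(t_{n-1}^+)=\widetilde U(t_{n-1}^-)$ and $$M\widetilde U^{(i+1)}(t_n^-)=\frac{\mathrm d^i}{\mathrm dt^i}\Big(F\big(t,\widetilde U(t)\big)\Big)\Big|_{t=t_n^-},\qquad i=0,\dots,\lfloor\tfrac k2\rfloor,$$ $$M\widetilde U^{(i+1)}(t_{n-1}^+)=\frac{\mathrm d^i}{\mathrm dt^i}\Big(F\big(t,\widetilde U(t)\big)\Big)\Big|_{t=t_{n-1}^+},\qquad \text{if }k\ge1,\ i=0,\dots,\lfloor\tfrac{k-1}2\rfloor,$$ $$M\widetilde U'(t_{n,i})=F\big(t_{n,i},\widetilde U(t_{n,i})\big),\qquad i=1,\dots,r-k.$$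
   Context: Problem: $M u'(t)=F(t,u(t))$, $u(t_0)=u_0\in\mathbb R^d$, with $M\in\mathbb R^{d\times d}$ regular; $F$ is sufficiently smooth (all derivatives of $F$ that occur exist and are continuous) and Lipschitz continuous in its second variable. Notation: $I_n=(t_{n-1},t_n]$ is a subinterval of the time mesh, $\tau_n=t_n-t_{n-1}>0$. $(\cdot,\cdot)$ is the Euclidean inner product on $\mathbb R^d$. $P_s(J,\mathbb R^q)$ is the space of $\mathbb R^q$-valued polynomials on $J$ of degree $\le s$, and $P_{-1}=\{0\}$. Values and derivatives at $t_{n-1}^+$ and $t_n^-$ are one-sided, taken from $I_n$; $\widetilde U(t_{n-1}^-)$ is the prescribed value inherited from the previous subinterval (or $u_0$ if $n=1$). Quadrature: for $0\le k\le r$ let $\widehat{\mathcal I}^r_k:C^{\lfloor k/2\rfloor}([-1,1])\to P_r([-1,1])$ be the Hermite interpolation operator preserving derivatives of orders $0,\dots,\lfloor\frac{k-1}{2}\rfloor$ at $-1$ (none if $k=0$), derivatives of orders $0,\dots,\lfloor\frac k2\rfloor$ at $+1$, and the function values at the zeros $\hat t_1,\dots,\hat t_{r-k}\in(-1,1)$ of the $(r-k)$th Jacobi polynomial with respect to the weight $(1+\hat t)^{\lfloor\frac{k-1}{2}\rfloor+1}(1-\hat t)^{\lfloor\frac k2\rfloor+1}$. Let $\widehat Q^r_k[\hat f]=\int_{-1}^1\widehat{\mathcal I}^r_k\hat f\,\mathrm d\hat t$; $\mathcal I^r_k$ and $Q^r_k$ denote their affine transformations to $I_n$ (so $Q^r_k[\varphi]=\int_{I_n}\mathcal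 I^r_k\varphi\,\mathrm dt$), and $t_{n,i}=\frac12(t_{n-1}+t_n+\tau_n\hat t_i)$, $i=1,\dots,r-k$. Local problem of $Q^r_k\text{-}\mathbf{VTD}^{r+1}_l$ ($1\le l\le k+2$): given $\widetilde U(t_{n-1}^-)$, find $\widetilde U\in P_{r+1}(I_n,\mathbb R^d)$ such that (1) $\widetilde U(t_{n-1}^+)=\widetilde U(t_{n-1}^-)$; (2) if $l\ge2$: $M\widetilde U^{(i+1)}(t_n^-)=\frac{\mathrm d^i}{\mathrm dt^i}\big(F(t,\widetilde U(t))\big)\big|_{t=t_n^-}$ for $i=0,\dots,\lfloor\frac l2\rfloor-1$; (3) if $l\ge3$: $M\widetilde U^{(i+1)}(t_{n-1}^+)=\frac{\mathrm d^i}{\mathrm dt^i}\big(F(t,\widetilde U(t))\big)\big|_{t=t_{n-1}^+}$ for $i=0,\dots,\lfloor\frac{l-1}2\rfloor-1$; (4) $Q^r_k\big[(M\widetilde U',\varphi)\big]=Q^r_k\big[(F(\cdot,\widetilde U(\cdot)),\varphi)\big]$ for all $\varphi\in P_{r+1-l}(I_n,\mathbb R^d)$ (no condition if $l=r+2$). *)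

(* Defs.v *)
From HB Require Import structures.
From mathcomp Require Import all_boot all_order all_algebra.
From mathcomp Require Import all_classical all_reals all_analysis.
Import Order.TTheory GRing.Theory Num.Theory.
Import numFieldNormedType.Exports.

Set Implicit Arguments.
Unset Strict Implicit.
Unset Printing Implicit Defensive.

Local Open Scope classical_set_scope.
Local Open Scope ring_scope.

(* f^(i)(x^-) and f^(i)(x^+): one-sided limits of the i-th derivative.  They
   depend only on f on one side of x. *)
Definition deriv_left (R : realType) (V : normedModType R) (i : nat)
    (f : R -> V) (x : R) : V :=
  lim (derive1n i f y @[y --> x^'-]).

Definition deriv_right (R : realType) (V : normedModType R) (i : nat)
    (f : R -> V) (x : R) : V :=
  lim (derive1n i f y @[y --> x^'+]).

(* Elements of P_s(J, R^d) are column vectors of polynomials.  The argument of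
   is_polyvec is s + 1, so that is_polyvec 0 is P_{-1} = {0}. *)
Definition is_polyvec (R : realType) (d n : nat) (U : 'cV[{poly R}]_d) : Prop :=
  forall j, (size (U j ord0) <= n)%N.

Definition evalv (R : realType) (d : nat) (U : 'cV[{poly R}]_d) (t : R) :
    'cV[R]_d :=
  \col_j (U j 0).[t].

Definition derivv (R : realType) (d i : nat) (U : 'cV[{poly R}]_d) :
    'cV[{poly R}]_d :=
  map_mx (derivn i) U.

Definition dotv (R : realType) (d : nat) (u v : 'cV[R]_d) : R :=
  \sum_j u j 0 * v j 0.

(* C^m on the closed strip [a, b] x R^d: g is continuous there, and its
   derivatives on the open strip extend to C^(m-1) maps on the closed strip.
   Nothing is required of g outside the closed strip. *)
Fixpoint Cm_strip (R : realType) (d : nat) (a b : R) (m : nat)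
    (g : R * 'cV[R]_d -> 'cV[R]_d) {struct m} : Prop :=
  {within `[a, b] `*` [set: 'cV[R]_d], continuous g} /\
  match m with
  | 0 => True
  | m'.+1 =>
      (forall z, (`]a, b[ `*` [set: 'cV[R]_d]) z -> differentiable g z) /\
      (forall v : R * 'cV[R]_d,
         exists2 h, Cm_strip a b m' h &
           forall z, (`]a, b[ `*` [set: 'cV[R]_d]) z -> 'D_v g z = h z)
  end.

(* The matrix norm is the sup norm; the existence of a Lipschitz constant does
   not depend on the choice of norm on R^d. *)
Definition lipschitz_snd (R : realType) (d : nat) (a b : R)
    (F : R -> 'cV[R]_d -> 'cV[R]_d) : Prop :=
  exists L : R, forall (t : R) (x y : 'cV[R]_d), t \in `[a, b] ->
    `|F t x - F t y| <= L * `|x - y|.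

Definition poly_int (R : realType) (a b : R) (p : {poly R}) : R :=
  Rintegral (@lebesgue_measure R) `[a, b] (fun x => p.[x]).

(* p is an m-th Jacobi polynomial for the weight (1 + x)^al (1 - x)^be on
   [-1, 1]; this determines p up to a nonzero factor. *)
Definition is_jacobi (R : realType) (al be m : nat) (p : {poly R}) : Prop :=
  size p = m.+1 /\
  forall q : {poly R}, (size q <= m)%N ->
    poly_int (-1) 1 ((1 + 'X) ^+ al * (1 - 'X) ^+ be * p * q) = 0.

(* In what follows uphalf k = floor ((k - 1) / 2) + 1, which is 0 for k = 0.
   Being injective, nd enumerates all the zeros. *)
Definition jacobi_nodes (R : realType) (r k : nat) (nd : 'I_(r - k) -> R) :
    Prop :=
  [/\ injective nd,
      forall i, -1 < nd i < 1
    & exists2 p, is_jacobi (uphalf k) (k./2).+1 (r - k) p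
               & forall i, root p (nd i)].

Definition is_hermite (R : realType) (r k : nat) (nd : 'I_(r - k) -> R)
    (f : R -> R) (p : {poly R}) : Prop :=
  [/\ (size p <= r.+1)%N,
      forall i, (i < uphalf k)%N -> (derivn i p).[-1] = deriv_right i f (-1),
      forall i, (i <= k./2)%N -> (derivn i p).[1] = deriv_left i f 1
    & forall i, p.[nd i] = f (nd i)].

Definition ref_interp (R : realType) (r k : nat) (nd : 'I_(r - k) -> R)
    (f : R -> R) : {poly R} :=
  xget 0 [set p | is_hermite nd f p].

Definition from_ref (R : realType) (a b s : R) : R := (a + b + (b - a) * s) / 2.

(* The inverse of from_ref a b, as a polynomial. *)
Definition to_ref (R : realType) (a b : R) : {poly R} :=
  (b - a)^-1 *: (2 *: 'X - (a + b)%:P).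

Definition interp (R : realType) (a b : R) (r k : nat) (nd : 'I_(r - k) -> R)
    (f : R -> R) : {poly R} :=
  ref_interp nd (fun s => f (from_ref a b s)) \Po to_ref a b.

Definition quad (R : realType) (a b : R) (r k : nat) (nd : 'I_(r - k) -> R)
    (f : R -> R) : R :=
  poly_int a b (interp a b nd f).

(* a and b stand for t_{n-1} and t_n, and u0 for the value inherited at
   t_{n-1}^-.  The indices 0 <= i <= floor (l / 2) - 1 of the conditions at b
   are those with i < l./2, and similarly at a. *)
Definition vtd_problem (R : realType) (d : nat) (M : 'M[R]_d)
    (F : R -> 'cV[R]_d -> 'cV[R]_d) (a b : R) (r k l : nat)
    (nd : 'I_(r - k) -> R) (u0 : 'cV[R]_d) (U : 'cV[{poly R}]_d) : Prop :=
  [/\ evalv U a = u0,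
      (2 <= l)%N -> forall i, (i < l./2)%N ->
        M *m evalv (derivv i.+1 U) b =
        deriv_left i (fun t => F t (evalv U t)) b,
      (3 <= l)%N -> forall i, (i < (l.-1)./2)%N ->
        M *m evalv (derivv i.+1 U) a =
        deriv_right i (fun t => F t (evalv U t)) a
    & forall phi : 'cV[{poly R}]_d, is_polyvec (r + 2 - l) phi ->
        quad a b nd (fun t => dotv (M *m evalv (derivv 1 U) t) (evalv phi t)) =
        quad a b nd (fun t => dotv (F t (evalv U t)) (evalv phi t))].

Definition collocation_problem (R : realType) (d : nat) (M : 'M[R]_d)
    (F : R -> 'cV[R]_d -> 'cV[R]_d) (a b : R) (r k : nat)
    (nd : 'I_(r - k) -> R) (u0 : 'cV[R]_d) (U : 'cV[{poly R}]_d) : Prop :=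
  [/\ evalv U a = u0,
      forall i, (i <= k./2)%N ->
        M *m evalv (derivv i.+1 U) b =
        deriv_left i (fun t => F t (evalv U t)) b,
      (1 <= k)%N -> forall i, (i <= (k.-1)./2)%N ->
        M *m evalv (derivv i.+1 U) a =
        deriv_right i (fun t => F t (evalv U t)) a
    & forall i, let t := from_ref a b (nd i) in
        M *m evalv (derivv 1 U) t = F t (evalv U t)].

(* Main.v *)
Require Import Defs.
From mathcomp Require Import all_boot all_order all_algebra.
From mathcomp Require Import all_classical all_reals all_analysis.
From mathcomp Require Import ring lra zify.
Import Order.TTheory GRing.Theory Num.Theory.
Import numFieldNormedType.Exports.
Set Implicit Arguments.
Unset Strict Implicit.
Unset Printing Implicit Defensive.
Local Open Scope classical_set_scope.
Local Open Scope ring_scope.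

(** Write e_j for the j-th component of the defect M U' - F(t, U(t)).  The
    collocation conditions say that the values and endpoint derivatives of e_j
    seen by the quadrature rule all vanish.  Replace the non-polynomial part
    of e_j by a polynomial with the same endpoint derivatives and node values
    and pull everything back to [-1, 1]: this yields a polynomial E_j, and,
    with W the nodal polynomial
      (X + 1)^K1 (X - 1)^K2 prod_i (X - nd i),  K1 + K2 = k + 1,
    Hermite interpolation is reduction modulo W, the rule is
    Lam(p) = int_(-1)^1 (p mod W) up to scaling ([quad_agrees]), and
    collocation means that W divides every E_j.

    Collocation implies the VTD conditions because E_j phi is then zero modulo
    W for each test polynomial phi, and because the VTD method imposes at most
    as many endpoint conditions.

    Conversely, the endpoint conditions of the VTD method make
    D = (X + 1)^L1 (X - 1)^L2 divide E_j, with L1 + L2 = l - 1, and the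
    variational condition says that Lam(E_j phi) = 0 for all phi with
    deg phi < deg (W / D) = r + 2 - l, hence for all phi since E_j (W / D) is
    zero modulo W ([nodal_poly_dvd_test]).  The ideal generated by E_j and W
    is thus annihilated by Lam.  If W did not divide E_j, this ideal would
    contain W / (X - c) for some root c of W ([quadrature_nondegenerate]).
    But Lam(W / (X - c)) is nonzero, being a multiple of a weight of a Gauss
    type rule ([poly_int_nodal_quotient_neq0]): the Jacobi orthogonality makes
    the rule exact in degree 2r - k, so this number can be compared with the
    integral of a polynomial of constant sign.

    Two facts link this algebra with F.  First, t |-> F(t, U(t)) is as smooth
    on the open interval as F on the strip, with one-sided limits of its
    derivatives, by the chain rule ([Cm_strip_agrees]).  Second, its endpoint
    derivatives and node values can be matched by a single polynomial
    ([agrees_primitive], [agrees_interpolate]). *)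

(** * Integrals and multiplicities of roots of real polynomials *)

Section PolyAlgebra.
Context {R : realType}.
Implicit Types (p q : {poly R}) (a b c : R).

Lemma poly_antiderivative p : exists P, P^`() = p.
Proof.
exists (\poly_(i < (size p).+1) (p`_i.-1 / i%:R)).
apply/polyP => i; rewrite coef_deriv coef_poly ltnS.
case: ltnP => [_|?]; last by rewrite nth_default // mul0rn.
by rewrite /= -[LHS]mulr_natr divfK // pnatr_eq0.
Qed.

Lemma poly_int_antiderivative a b p P : a < b -> P^`() = p ->
  poly_int a b p = P.[b] - P.[a].
Proof.
move=> lt_ab <-; rewrite /poly_int /Rintegral.
rewrite (@continuous_FTC2 _ _ (horner P)) //.
- by apply: continuous_subspaceT => x; exact: continuous_horner.
- split => [x _||]; first exact: derivable_horner.
  + exact/cvg_at_right_filter/continuous_horner.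
  + exact/cvg_at_left_filter/continuous_horner.
- by move=> x _; rewrite derivE.
Qed.

Lemma poly_intD a b p q : a < b ->
  poly_int a b (p + q) = poly_int a b p + poly_int a b q.
Proof.
move=> ab; have [P dP] := poly_antiderivative p.
have [Q dQ] := poly_antiderivative q.
rewrite (poly_int_antiderivative ab dP) (poly_int_antiderivative ab dQ).
rewrite (@poly_int_antiderivative _ _ _ (P + Q)) ?derivD ?dP ?dQ //.
by rewrite !hornerD opprD addrACA.
Qed.

Lemma poly_intZ a b c p : a < b -> poly_int a b (c *: p) = c * poly_int a b p.
Proof.
move=> ab; have [P dP] := poly_antiderivative p.
rewrite (poly_int_antiderivative ab dP).
rewrite (@poly_int_antiderivative _ _ _ (c *: P)) ?derivZ ?dP //.
by rewrite !hornerE mulrBr.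
Qed.

Lemma poly_intB a b p q : a < b ->
  poly_int a b (p - q) = poly_int a b p - poly_int a b q.
Proof. by move=> ab; rewrite poly_intD // -[- q]scaleN1r poly_intZ // mulN1r. Qed.

Lemma poly_int0 a b : a < b -> poly_int a b 0 = 0.
Proof. by move=> ab; rewrite -(scale0r 0) poly_intZ // mul0r. Qed.

Lemma poly_int_comp_affine a b c d p : a < b -> 0 < c ->
  poly_int (c * a + d) (c * b + d) p =
  c * poly_int a b (p \Po (c *: 'X + d%:P)).
Proof.
move=> ab c0; have [P dP] := poly_antiderivative p.
rewrite (@poly_int_antiderivative _ _ _ P) //; last first.
  by rewrite ltrD2r ltr_pM2l.
rewrite -poly_intZ //.
rewrite (@poly_int_antiderivative _ _ _ (P \Po (c *: 'X + d%:P))) //.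
  by rewrite !horner_comp !hornerE.
rewrite deriv_comp dP derivD derivZ derivX derivC addr0.
by rewrite -alg_polyC mulrC mulr_algl.
Qed.

(** A primitive of a nonnegative polynomial is nondecreasing; if its endpoint
    values were equal it would be constant on the interval, hence a constant
    polynomial. *)
Lemma poly_int_gt0 a b p : a < b -> p != 0 ->
  (forall x, a < x < b -> 0 <= p.[x]) -> 0 < poly_int a b p.
Proof.
move=> ab p0 pge0; have [P dP] := poly_antiderivative p.
rewrite (poly_int_antiderivative ab dP) subr_gt0.
have incr : {in `[a, b]%R &, {homo horner P : x y / x <= y}}.
  apply: ger0_derive1_le_cc => [x _|x|]; first exact: derivable_horner.
    by rewrite -derivE dP in_itv /=; exact: pge0.
  by apply: continuous_subspaceT => x; exact: continuous_horner.
have ain : a \in `[a, b]%R by rewrite in_itv /= lexx ltW.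
have bin : b \in `[a, b]%R by rewrite in_itv /= lexx ltW.
rewrite lt_neqAle incr ?(ltW ab) // andbT; apply: contra p0 => /eqP Pab.
pose Q := P - P.[a]%:P.
have Q0 x : x \in `[a, b]%R -> Q.[x] = 0.
  move=> xab; apply/eqP; rewrite !hornerE subr_eq0 eq_le {1}Pab.
  by move: (xab); rewrite in_itv /= => /andP[ax xb]; rewrite !incr.
suff : Q = 0.
  by move=> /(congr1 deriv); rewrite derivB derivC subr0 deriv0 dP => ->.
apply/eqP/negPn/negP => Qn0.
pose s := [seq a + (b - a) / i.+1%:R | i <- iota 0 (size Q)].
have : (size s < size Q)%N.
  apply: max_poly_roots => //.
    apply/allP => _ /mapP[i _ ->]; apply/eqP/Q0.
    rewrite in_itv /= lerDl -lerBrDl; apply/andP; split.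
      by rewrite divr_ge0 ?ler0n // subr_ge0 ltW.
    by rewrite ler_pdivrMr ?ltr0n // ler_peMr ?subr_ge0 ?(ltW ab) // ler1n.
  rewrite map_inj_uniq ?iota_uniq // => i j /addrI.
  move=> /(mulfI _); rewrite subr_eq0 gt_eqF // => /(_ isT) /invr_inj /eqP.
  by rewrite eqr_nat => /eqP [].
by rewrite size_map size_iota ltnn.
Qed.

(** If the derivatives of orders 0 to K of p vanish at c then, inductively,
    p = s (X - c)^K and (X - c)^K divides p'; hence X - c divides K s, and
    K is invertible in characteristic zero, so (X - c)^(K+1) divides p. *)
Lemma dvdp_derivnP c K p :
  (forall i, (i < K)%N -> (p^`(i)).[c] = 0) <-> (('X - c%:P) ^+ K %| p).
Proof.
elim: K p => [|K IH] p; first by rewrite expr0 dvd1p.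
split=> [p0|].
- have /IH/dvdpP[t dp] : forall i, (i < K)%N -> ((p^`())^`(i)).[c] = 0.
    by move=> i iK; rewrite -derivSn p0.
  have /IH/dvdpP[s ps] : forall i, (i < K)%N -> (p^`(i)).[c] = 0.
    by move=> i iK; rewrite p0 // ltnW.
  case: K => [|K] in p0 ps dp IH *.
    by rewrite expr1 dvdp_XsubCl /root (p0 0%N).
  rewrite ps exprS; apply: dvdp_mul => //.
  rewrite dvdp_XsubCl /root.
  have /(congr1 (horner^~ c)) : s *+ K.+1 = (t - s^`()) * ('X - c%:P).
    have X0 : ('X - c%:P) ^+ K != 0 by rewrite expf_neq0 // polyXsubC_eq0.
    apply: (mulIf X0); move: dp; rewrite ps derivM deriv_exp derivXsubC mul1r => dp.
    rewrite -mulrA -exprS mulrBl -dp; ring.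
  by rewrite hornerMn hornerM hornerXsubC subrr mulr0 => /eqP; rewrite mulrn_eq0.
- move=> /dvdpP[q ->] [_|i].
    by rewrite hornerM horner_exp hornerXsubC subrr expr0n mulr0.
  rewrite ltnS derivSn; apply/IH: i.
  rewrite derivM exprS; apply: dvdp_add; first by rewrite !dvdp_mull.
  by rewrite -exprS deriv_exp derivXsubC mul1r -mulr_natl dvdp_mull // dvdp_mull.
Qed.
End PolyAlgebra.

(** * The nodal polynomial and nondegeneracy of the quadrature rule *)

Definition nodal_poly (R : realType) (K1 K2 m : nat) (nd : 'I_m -> R) : {poly R} :=
  ('X - (-1)%:P) ^+ K1 * ('X - 1%:P) ^+ K2 * \prod_i ('X - (nd i)%:P).

(** The roots of [nodal_poly], with multiplicity: the splitting into linear
    factors is what gives every proper divisor a complementary root. *)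
Definition nodal_seq (R : realType) (K1 K2 m : nat) (nd : 'I_m -> R) : seq R :=
  nseq K1 (-1) ++ nseq K2 1 ++ codom nd.

Section NodalPolynomial.
Context {R : realType} (K1 K2 m : nat) (nd : 'I_m -> R).
Let W := nodal_poly K1 K2 nd.

Lemma nodal_polyE : W = \prod_(z <- nodal_seq K1 K2 nd) ('X - z%:P).
Proof.
have nseqE n c : \prod_(z <- nseq n c) ('X - z%:P) = ('X - c%:P) ^+ n.
  by elim: n => [|n IH]; rewrite ?big_nil //= big_cons IH exprS.
by rewrite !big_cat !nseqE /= mulrA /codom big_image.
Qed.

Lemma nodal_poly_monic : W \is monic.
Proof. by rewrite nodal_polyE monic_prod_XsubC. Qed.

Lemma nodal_poly_neq0 : W != 0.
Proof. exact/monic_neq0/nodal_poly_monic. Qed.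

Lemma size_nodal_poly : size W = (K1 + K2 + m).+1.
Proof.
by rewrite nodal_polyE size_prod_XsubC !size_cat !size_nseq size_codom card_ord addnA.
Qed.

End NodalPolynomial.

Section Quadrature.
Context {R : realType} (K1 K2 m : nat) (nd : 'I_m -> R).
Implicit Types (p q : {poly R}) (c : R).
Let W := nodal_poly K1 K2 nd.
Let omega : {poly R} := \prod_i ('X - (nd i)%:P).

(** The nodal polynomial is the Jacobi polynomial times its weight, up to a
    constant factor. *)
Lemma nodal_poly_orthogonal p : injective nd -> is_jacobi K1 K2 m p ->
  (forall i, root p (nd i)) ->
  forall q, (size q <= m)%N -> poly_int (-1) 1 (W * q) = 0.
Proof.
move=> inj_nd [szp orth] rootp q szq.
have N11 : -1 < 1 :> R by lra.
have p0 : p != 0 by rewrite -size_poly_eq0 szp.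
have dp : p = lead_coef p *: omega.
  have -> : omega = \prod_(z <- codom nd) ('X - z%:P) by rewrite big_image.
  apply: all_roots_prod_XsubC.
  - by rewrite szp size_image card_ord.
  - by apply/allP => z /codomP[i ->].
  - by rewrite uniq_rootsE map_inj_uniq // enum_uniq.
have eW : (1 + 'X) ^+ K1 * (1 - 'X) ^+ K2 * p * q =
          ((-1) ^+ K2 * lead_coef p) *: (W * q).
  rewrite [in LHS]dp /W /nodal_poly -/omega polyCN opprK polyC1.
  have -> : 1 - 'X = (-1) *: ('X - 1) :> {poly R} by rewrite scaleN1r opprB.
  by rewrite exprZn [1 + _]addrC -!scalerAr -!scalerAl scalerA mulrC.
move: (orth q szq); rewrite eW poly_intZ // => /eqP.
by rewrite !mulf_eq0 signr_eq0 lead_coef_eq0 (negPf p0) => /eqP.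
Qed.

Hypothesis orthW : forall q, (size q <= m)%N -> poly_int (-1) 1 (W * q) = 0.

Lemma poly_int_weighted_square_neq0 i j (s : {poly R}) : s != 0 ->
  poly_int (-1) 1 (('X - (-1)%:P) ^+ i * ('X - 1%:P) ^+ j * s ^+ 2) != 0.
Proof.
move=> s0; have N11 : -1 < 1 :> R by lra.
set p := (X in poly_int _ _ X).
have p0 : p != 0 by rewrite !mulf_neq0 ?expf_neq0 ?polyXsubC_eq0.
suff : 0 < (-1) ^+ j * poly_int (-1) 1 p.
  by apply: contraTneq => ->; rewrite mulr0 ltxx.
rewrite -poly_intZ //; apply: poly_int_gt0 => // [|x /andP[x1 x2]].
  by rewrite scaler_eq0 signr_eq0.
rewrite hornerZ /p !(horner_exp, hornerM, hornerXsubC) opprK.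
rewrite mulrA; apply: mulr_ge0; last exact: sqr_ge0.
rewrite mulrCA -exprMn.
by apply: mulr_ge0; apply: exprn_ge0; lra.
Qed.

(** The integral of W / (X - c) is a nonzero multiple of the quadrature weight
    of the highest derivative taken at the node c.  By orthogonality,
    multiplying W / (X - c) by a polynomial phi of degree at most m multiplies
    the integral by phi(c); the choice of phi makes the integrand of constant
    sign. *)
Lemma poly_int_nodal_quotient_neq0 c Wc :
  W = Wc * ('X - c%:P) -> poly_int (-1) 1 Wc != 0.
Proof.
move=> dW; have N11 : -1 < 1 :> R by lra.
have X0 : 'X - c%:P != 0 :> {poly R} by rewrite polyXsubC_eq0.
have szomega : size omega = m.+1.
  by rewrite size_prod_XsubC /index_enum -enumT size_enum_ord.
have omega0 : omega != 0 by rewrite -size_poly_eq0 szomega.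
suff [phi [i [j [s [s0 szphi Wcphi]]]]] :
  exists (phi : {poly R}) i j (s : {poly R}), [/\ s != 0,
    (size phi <= m.+1)%N &
    Wc * phi = ('X - (-1)%:P) ^+ i * ('X - 1%:P) ^+ j * s ^+ 2].
  have := poly_int_weighted_square_neq0 i j s0; rewrite -Wcphi.
  apply: contra => /eqP Wc0.
  have /factor_theorem[t dt] : root (phi - phi.[c]%:P) c.
    by rewrite /root !hornerE subrr.
  have szt : (size t <= m)%N.
    have [->|t0] := eqVneq t 0; first by rewrite size_poly0.
    have : (size (t * ('X - c%:P))%R <= m.+1)%N.
      rewrite -dt (leq_trans (size_polyD _ _)) // geq_max szphi size_polyN.
      by rewrite (leq_trans (size_polyC_leq1 _)).
    by rewrite size_Mmonic ?monicXsubC // size_XsubC addn2.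
  have -> : Wc * phi = phi.[c] *: Wc + W * t.
    rewrite -[phi in LHS](subrK phi.[c]%:P) dt dW -mul_polyC; ring.
  by rewrite poly_intD // poly_intZ // Wc0 mulr0 add0r orthW.
have : root W c by rewrite dW rootM root_XsubC eqxx orbT.
rewrite /W nodal_polyE root_prod_XsubC !mem_cat !mem_nseq => /or3P[/andP[K0]|/andP[K0]|].
- move=> /eqP cE; exists omega, K1.-1, K2, omega; split => //; first by rewrite szomega.
  suff -> : Wc = ('X - (-1)%:P) ^+ K1.-1 * ('X - 1%:P) ^+ K2 * omega.
    by rewrite -mulrA -expr2.
  apply: (mulIf X0); rewrite -dW cE /W /nodal_poly -/omega -{1}(prednK K0) exprS.
  by ring.
- move=> /eqP cE; exists omega, K1, K2.-1, omega; split => //; first by rewrite szomega.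
  suff -> : Wc = ('X - (-1)%:P) ^+ K1 * ('X - 1%:P) ^+ K2.-1 * omega.
    by rewrite -mulrA -expr2.
  apply: (mulIf X0); rewrite -dW cE /W /nodal_poly -/omega -{1}(prednK K0) exprS.
  by ring.
- case/codomP => n cE; pose s := \prod_(i | i != n) ('X - (nd i)%:P).
  have domega : omega = ('X - c%:P) * s by rewrite /omega (bigD1 n) //= cE.
  have s0 : s != 0 by apply: contraNneq omega0 => s0; rewrite domega s0 mulr0.
  exists s, K1, K2, s; split => //.
    by rewrite -szomega; apply: dvdp_leq => //; rewrite domega dvdp_mull.
  suff -> : Wc = ('X - (-1)%:P) ^+ K1 * ('X - 1%:P) ^+ K2 * s.
    by rewrite -mulrA -expr2.
  by apply: (mulIf X0); rewrite -dW /W /nodal_poly -/omega domega; ring.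
Qed.

(** The rule vanishes on the ideal generated by p and W.  If W does not divide
    p, this ideal is generated by a proper divisor of W, so it contains
    W / (X - c) for some root c of W.  The degree of W / (X - c) is less than
    that of W, so the rule returns its integral, which is nonzero. *)
Lemma quadrature_nondegenerate p :
  (forall q, poly_int (-1) 1 ((p * q) %% W) = 0) -> W %| p.
Proof.
move=> p_annih; have N11 : -1 < 1 :> R by lra.
have W0 : W != 0 := nodal_poly_neq0 _ _ _.
pose V := gcdp p W.
have V_annih q : poly_int (-1) 1 ((V * q) %% W) = 0.
  have [u /eqpP[[c1 c2] /= /andP[c10 c20]]] := Bezoutp p W; rewrite -/V => dV.
  apply: (mulfI c20); rewrite mulr0 -poly_intZ // -modpZl scalerAl -dV.
  rewrite -scalerAl mulrDl modpZl modpD [X in _ + X](_ : _ = 0) ?addr0.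
    by rewrite poly_intZ // [u.1 * p]mulrC -mulrA p_annih mulr0.
  by apply/eqP; rewrite -/(_ %| _) mulrAC dvdp_mull.
have /dvdpP[Z dW] : V %| W by rewrite dvdp_gcdr.
have Z0 : Z != 0 by apply/eqP => Z0; move: W0; rewrite dW Z0 mul0r eqxx.
apply/negPn/negP => Wp.
have szZ : size Z != 1%N.
  apply: contra Wp => /size_poly1P[c c0 dZ].
  by rewrite dW dZ mul_polyC dvdpZl // dvdp_gcdl.
have /dvdp_prod_XsubC[mk Zeq] : Z %| \prod_(z <- nodal_seq K1 K2 nd) ('X - z%:P).
  by rewrite -nodal_polyE -/W dW dvdp_mulr.
have [c rZ] : exists c, root Z c.
  case dmk : (mask mk (nodal_seq K1 K2 nd)) => [|c s].
    by case/negP: szZ; rewrite (eqp_size Zeq) dmk big_nil size_poly1.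
  by exists c; rewrite (eqp_root Zeq) dmk big_cons rootM root_XsubC eqxx.
have /factor_theorem[Z' dZ] := rZ.
have dWc : W = V * Z' * ('X - c%:P) by rewrite dW dZ; ring.
have := poly_int_nodal_quotient_neq0 dWc; rewrite -(V_annih Z') modp_small ?eqxx //.
have VZ0 : V * Z' != 0 by apply/eqP => VZ0; move: W0; rewrite dWc VZ0 mul0r eqxx.
by rewrite dWc (size_Mmonic VZ0) ?monicXsubC // size_XsubC addn2.
Qed.

(** Each endpoint condition known beforehand saves one degree in the test
    polynomials q: if D = (X + 1)^L1 (X - 1)^L2 divides p, then W divides
    p (W / D), so that only the residue of q modulo W / D matters. *)
Lemma nodal_poly_dvd_test L1 L2 p : (L1 <= K1)%N -> (L2 <= K2)%N ->
  ('X - (-1)%:P) ^+ L1 * ('X - 1%:P) ^+ L2 %| p ->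
  (forall q, (size q <= K1 - L1 + (K2 - L2) + m)%N ->
     poly_int (-1) 1 ((p * q) %% W) = 0) ->
  W %| p.
Proof.
move=> LK1 LK2 /dvdpP[g dp] p_annih; apply: quadrature_nondegenerate => q.
pose W' := nodal_poly (K1 - L1) (K2 - L2) nd.
have W'0 : W' != 0 := nodal_poly_neq0 _ _ _.
have szW' : size W' = (K1 - L1 + (K2 - L2) + m).+1 := size_nodal_poly _ _ _.
have pW' : W %| p * W'.
  rewrite dp /W /nodal_poly -/omega -(subnKC LK1) -(subnKC LK2) !exprD.
  apply/dvdpP; exists g; rewrite /W' /nodal_poly -/omega; ring.
rewrite (divp_eq q W') mulrDr modpD mulrCA [X in X + _](_ : _ = 0) ?add0r.
  by apply: p_annih; rewrite -ltnS -szW' ltn_modp.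
by apply/eqP; rewrite -/(_ %| _) dvdp_mull.
Qed.
End Quadrature.

(** * Functions with the endpoint derivatives of a polynomial *)

(** The function f is m times differentiable on the open interval, in the
    sense that its derivatives of order less than m are differentiable there,
    and up to order m its one-sided derivatives at a and at b are those of p.
    Recording the limits by a polynomial turns the Leibniz and chain rules for
    them into the corresponding identities for polynomials.  The recursion
    differentiates f first, which suits induction on the smoothness of F. *)
Fixpoint agrees (R : realType) (a b : R) (m : nat) (f : R -> R)
    (p : {poly R}) {struct m} : Prop :=
  [/\ f x @[x --> a^'+] --> p.[a], f x @[x --> b^'-] --> p.[b] &
      match m with
      | 0 => True
      | m'.+1 => (forall x, a < x < b -> derivable f x 1) /\
                 agrees a b m' (derive1 f) (deriv p)
      end].

Section Agrees.
Context {R : realType} (a b : R) (lt_ab : a < b).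
Implicit Types (f g : R -> R) (p q : {poly R}).

Let near_oo x (P : R -> Prop) : a < x < b ->
  (forall y, a < y < b -> P y) -> \forall y \near x, P y.
Proof.
move=> xab Pab; have : x \in `]a, b[%R by rewrite in_itv.
by move/near_in_itvoo; apply: filterS => y; rewrite in_itv; exact: Pab.
Qed.

Let near_left_end (P : R -> Prop) :
  (forall y, a < y < b -> P y) -> \forall y \near a^'+, P y.
Proof.
move=> Pab; near=> y; apply: Pab; apply/andP; split; near: y.
  exact: nbhs_right_gt.
exact: nbhs_right_lt.
Unshelve. all: by end_near. Qed.

Let near_right_end (P : R -> Prop) :
  (forall y, a < y < b -> P y) -> \forall y \near b^'-, P y.
Proof.
move=> Pab; near=> y; apply: Pab; apply/andP; split; near: y.
  exact: nbhs_left_gt.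
exact: nbhs_left_lt.
Unshelve. all: by end_near. Qed.

Lemma agrees_eq m f g p : (forall x, a < x < b -> f x = g x) ->
  agrees a b m f p -> agrees a b m g p.
Proof.
elim: m f g p => [|m IH] f g p fg [fa fb] fm; split => //.
- by apply: cvg_trans fa; apply/near_eq_cvg/near_left_end => y /fg ->.
- by apply: cvg_trans fb; apply/near_eq_cvg/near_right_end => y /fg ->.
- by apply: cvg_trans fa; apply/near_eq_cvg/near_left_end => y /fg ->.
- by apply: cvg_trans fb; apply/near_eq_cvg/near_right_end => y /fg ->.
- case: fm => df fm; split.
    move=> x xab; apply: near_eq_derivable (df x xab); exact: near_oo.
  apply: IH fm => x xab; rewrite !derive1E; apply: near_eq_derive.
  exact: near_oo.
Qed.

(** The product rule below pairs f' with g itself, hence needs g at one order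
    less than given. *)
Lemma agreesS m f p : agrees a b m.+1 f p -> agrees a b m f p.
Proof.
elim: m f p => [|m IH] f p; first by case=> fa fb _; split.
by case=> fa fb [df fm]; split => //; split => //; exact: IH.
Qed.

Lemma agreesD m f g p q : agrees a b m f p -> agrees a b m g q ->
  agrees a b m (fun x => f x + g x) (p + q).
Proof.
elim: m f g p q => [|m IH] f g p q [fa fb fm] [ga gb gm];
  split; rewrite ?hornerD //; try exact: cvgD.
case: fm gm => df fm [dg gm]; split.
  by move=> x xab; apply: derivableD; [exact: df | exact: dg].
rewrite derivD; apply: agrees_eq (IH _ _ _ _ fm gm) => x xab /=.
by rewrite !derive1E deriveD //; [exact: df | exact: dg].
Qed.

Lemma agreesM m f g p q : agrees a b m f p -> agrees a b m g q ->
  agrees a b m (fun x => f x * g x) (p * q).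
Proof.
elim: m f g p q => [|m IH] f g p q fp gq.
  by move: fp gq => [fa fb _] [ga gb _]; split; rewrite ?hornerM //; exact: cvgM.
move: (fp) (gq) => [fa fb [df fm]] [ga gb [dg gm]].
split; rewrite ?hornerM; try exact: cvgM.
split; first by move=> x xab; apply: derivableM; [exact: df | exact: dg].
rewrite derivM.
have := agreesD (IH _ _ _ _ fm (agreesS gq)) (IH _ _ _ _ (agreesS fp) gm).
apply: agrees_eq => x xab; rewrite !derive1E deriveM; last 2 first.
- exact: df.
- exact: dg.
by rewrite addrC /= /GRing.scale /=; ring.
Qed.

Lemma agrees_horner m p : agrees a b m (horner p) p.
Proof.
have c q : (horner q x @[x --> a^'+] --> q.[a]) /\ (horner q x @[x --> b^'-] --> q.[b]).
  split; first exact/cvg_at_right_filter/continuous_horner.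
  exact/cvg_at_left_filter/continuous_horner.
elim: m p => [|m IH] p; have [ca cb] := c p; split => //.
by split => [x _|]; [exact: derivable_horner | rewrite -derivE].
Qed.

Lemma agrees_sum m n (f : 'I_n -> R -> R) (p : 'I_n -> {poly R}) :
  (forall j, agrees a b m (f j) (p j)) ->
  agrees a b m (fun x => \sum_j f j x) (\sum_j p j).
Proof.
elim: n f p => [|n IH] f p fp.
  rewrite big_ord0; apply: agrees_eq (agrees_horner m 0) => x _.
  by rewrite big_ord0 horner0.
rewrite big_ord_recl.
apply: agrees_eq (agreesD (fp ord0) (IH _ _ (fun j => fp (lift ord0 j)))) => x _.
by rewrite [RHS]big_ord_recl.
Qed.

Lemma agrees_derive1n m i f p : (i <= m)%N -> agrees a b m f p ->
  agrees a b (m - i) (derive1n i f) (derivn i p).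
Proof.
elim: i m f p => [|i IH] m f p; first by rewrite subn0.
case: m => // m; rewrite ltnS subSS derive1Sn derivSn => im [_ _ [_ fm]].
exact: IH.
Qed.

Lemma agrees_derivable m i f p x : (i < m)%N -> agrees a b m f p ->
  a < x < b -> derivable (derive1n i f) x 1.
Proof.
move=> im /(agrees_derive1n (ltnW im)).
have -> : (m - i = (m - i.+1).+1)%N by rewrite subnSK.
by case=> _ _ [df _]; exact: df.
Qed.

Lemma agrees_cvg m i f p : (i <= m)%N -> agrees a b m f p ->
  derive1n i f x @[x --> a^'+] --> (derivn i p).[a] /\
  derive1n i f x @[x --> b^'-] --> (derivn i p).[b].
Proof.
by move=> im /(agrees_derive1n im); case: (m - i)%N => [|n] [].
Qed.

Lemma agrees_deriv_right m i f p : (i <= m)%N -> agrees a b m f p ->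
  deriv_right i f a = (derivn i p).[a].
Proof. by move=> im /(agrees_cvg im)[fa _]; exact: cvg_lim. Qed.

Lemma agrees_deriv_left m i f p : (i <= m)%N -> agrees a b m f p ->
  deriv_left i f b = (derivn i p).[b].
Proof. by move=> im /(agrees_cvg im)[_ fb]; exact: cvg_lim. Qed.

(** Only the class of p modulo (X - a)^(m+1) and (X - b)^(m+1) matters, which
    leaves p free to be modified away from the endpoints. *)
Lemma agrees_congr m f p q :
  ('X - a%:P) ^+ m.+1 %| p - q -> ('X - b%:P) ^+ m.+1 %| p - q ->
  agrees a b m f p -> agrees a b m f q.
Proof.
have ev c n (r s : {poly R}) : ('X - c%:P) ^+ n.+1 %| r - s -> r.[c] = s.[c].
  move=> /dvdp_derivnP /(_ 0%N isT) /eqP.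
  by rewrite derivn0 hornerD hornerN subr_eq0 => /eqP.
have dv c n (r s : {poly R}) : ('X - c%:P) ^+ n.+2 %| r - s ->
    ('X - c%:P) ^+ n.+1 %| r^`() - s^`().
  move=> /dvdp_derivnP h; apply/dvdp_derivnP => i ilt.
  by rewrite -derivB -derivSn h.
elim: m f p q => [|m IH] f p q pa pb [fa fb fm].
  by split => //; rewrite -?(ev _ _ _ _ pa) -?(ev _ _ _ _ pb).
split; rewrite -?(ev _ _ _ _ pa) -?(ev _ _ _ _ pb) //.
by case: fm => df fm; split => //; apply: IH fm; exact: dv.
Qed.
End Agrees.

(** * Changing variables, integrating and interpolating *)

Section AgreesExistence.
Context {R : realType}.
Implicit Types (a b c d : R) (f g : R -> R) (p q : {poly R}).

Lemma horner_affine c d x : (c *: 'X + d%:P).[x] = c * x + d.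
Proof. by rewrite !hornerE. Qed.

Lemma affine_at_right a c d : 0 < c ->
  c * s + d @[s --> a^'+] --> (c * a + d)^'+.
Proof.
move=> c0 A; rewrite /at_right /within /= => cA.
have : c * s + d @[s --> a] --> c * a + d.
  have := @continuous_horner R (c *: 'X + d%:P) a.
  by rewrite /continuous_at horner_affine; under eq_cvg do rewrite horner_affine.
move=> /(_ _ cA) h0.
have h : \forall s \near a, c * a + d < c * s + d -> A (c * s + d) := h0.
suff : \forall s \near a, a < s -> A (c * s + d) by [].
move: h; apply: filterS => s + als; apply.
by rewrite ltrD2r ltr_pM2l.
Qed.

Lemma affine_at_left a c d : 0 < c ->
  c * s + d @[s --> a^'-] --> (c * a + d)^'-.
Proof.
move=> c0 A; rewrite /at_left /within /= => cA.
have : c * s + d @[s --> a] --> c * a + d.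
  have := @continuous_horner R (c *: 'X + d%:P) a.
  by rewrite /continuous_at horner_affine; under eq_cvg do rewrite horner_affine.
move=> /(_ _ cA) h0.
have h : \forall s \near a, c * s + d < c * a + d -> A (c * s + d) := h0.
suff : \forall s \near a, s < a -> A (c * s + d) by [].
move: h; apply: filterS => s + als; apply.
by rewrite ltrD2r ltr_pM2l.
Qed.

Lemma agrees_comp_affine a b c d m f p : a < b -> 0 < c ->
  agrees (c * a + d) (c * b + d) m f p ->
  agrees a b m (fun s => f (c * s + d)) (p \Po (c *: 'X + d%:P)).
Proof.
move=> ab c0; elim: m f p => [|m IH] f p [fa fb fm].
  split => //; rewrite horner_comp !hornerE.
    by apply: cvg_comp fa; exact: affine_at_right.
  by apply: cvg_comp fb; exact: affine_at_left.
split; rewrite ?horner_comp ?hornerE.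
- by apply: cvg_comp fa; exact: affine_at_right.
- by apply: cvg_comp fb; exact: affine_at_left.
- case: fm => df fm.
  have daff (x : R) : is_derive x (1 : R) (fun s : R => c * s + d) c.
    have -> : (fun s : R => c * s + d) = horner (c *: 'X + d%:P).
      by apply/funext => s; rewrite horner_affine.
    apply: is_derive_eq; rewrite derivD derivZ derivX derivC addr0.
    by rewrite !hornerE.
  have dfx x : a < x < b -> derivable f (c * x + d) 1.
    by move=> /andP[ax xb]; apply: df; rewrite !ltrD2r !ltr_pM2l // ax.
  split.
    move=> x xab; apply/derivable1_diffP/(@differentiable_comp _ _ _ _ (fun s => c * s + d) f).
      by apply/derivable1_diffP; have [] := daff x.
    exact/derivable1_diffP/dfx.
  have -> : (p \Po (c *: 'X + d%:P))^`() = (p^`() \Po (c *: 'X + d%:P)) * c%:P.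
    by rewrite deriv_comp derivD derivZ derivX derivC addr0 -mul_polyC mulr1.
  have := agreesM ab (IH _ _ fm) (agrees_horner a b m c%:P).
  apply: agrees_eq => // x xab; rewrite hornerC.
  rewrite (derive1_comp (f := fun s => c * s + d) (g := f)); last 2 first.
  + by have [] := daff x.
  + exact: dfx.
  by congr (_ * _); rewrite derive1E; have [_ ->] := daff x.
Qed.

(** A primitive of the polynomial attached to f' has the right value at one
    endpoint only; adding a multiple of a primitive of
    ((X - a) (b - X)) ^ (m + 1) corrects the other one without disturbing
    the derivatives. *)
Lemma agrees_primitive a b m f q (fa fb : R) : a < b ->
  f x @[x --> a^'+] --> fa -> f x @[x --> b^'-] --> fb ->
  (forall x, a < x < b -> derivable f x 1) ->
  agrees a b m (derive1 f) q -> exists p, agrees a b m.+1 f p.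
Proof.
move=> ab cfa cfb df fq.
have [P dP] := poly_antiderivative q.
pose w : {poly R} := ('X - a%:P) ^+ m.+1 * (b%:P - 'X) ^+ m.+1.
have [B dB] := poly_antiderivative w.
have dlt : B.[b] - B.[a] != 0.
  rewrite -(poly_int_antiderivative ab dB) gt_eqF //.
  apply: poly_int_gt0 => // [|x /andP[ax xb]].
    have bX0 : b%:P - 'X != 0 :> {poly R}.
      by rewrite -[b%:P - 'X]opprB oppr_eq0 polyXsubC_eq0.
    by apply: mulf_neq0; apply: expf_neq0 => //; rewrite polyXsubC_eq0.
  rewrite /w hornerM !horner_exp !hornerE -exprMn exprn_ge0 // mulr_ge0 //.
    by rewrite subr_ge0 ltW.
  by rewrite subr_ge0 ltW.
(* The excess of f(b) - f(a) over P(b) - P(a), in units of B(b) - B(a) *)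
pose e := (fb - P.[b] + P.[a] - fa) / (B.[b] - B.[a]).
exists (P + (fa - P.[a])%:P + e *: (B - B.[a]%:P)); split.
- by rewrite !(hornerD, hornerZ, hornerN, hornerC) subrr mulr0 addr0 addrC subrK.
- rewrite !(hornerD, hornerZ, hornerN, hornerC) /e divfK //.
  suff -> : P.[b] + (fa - P.[a]) + (fb - P.[b] + P.[a] - fa) = fb by [].
  by move: P.[b] P.[a] => u v; ring.
- split => //; rewrite !derivD derivZ derivB !derivC subr0 addr0 dP dB.
  apply: agrees_congr fq => //; rewrite opprD addNKr dvdpNr -mul_polyC dvdp_mull // /w.
    by rewrite dvdp_mulr.
  have -> : b%:P - 'X = (-1) * ('X - b%:P) by rewrite mulN1r opprB.
  by rewrite exprMn !dvdp_mull.
Qed.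

(** The endpoint derivatives do not see multiples of
    ((X - a) (X - b)) ^ (m + 1), which leaves room for Lagrange
    interpolation at interior points. *)
Lemma agrees_interpolate a b m n f p (t : 'I_n -> R) : a < b -> injective t ->
  (forall i, a < t i < b) -> agrees a b m f p ->
  exists2 q, agrees a b m f q & forall i, q.[t i] = f (t i).
Proof.
move=> ab inj_t t_in fp.
pose w : {poly R} := ('X - a%:P) ^+ m.+1 * ('X - b%:P) ^+ m.+1.
pose l i : {poly R} := w * \prod_(j | j != i) ('X - (t j)%:P).
have l0 i : (l i).[t i] != 0.
  rewrite hornerM mulf_neq0 //.
    rewrite hornerM !horner_exp !hornerXsubC mulf_neq0 // expf_neq0 // subr_eq0.
      by rewrite gt_eqF //; case/andP: (t_in i).
    by rewrite lt_eqF //; case/andP: (t_in i).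
  rewrite horner_prod; apply/prodf_neq0 => j ji.
  by rewrite hornerXsubC subr_eq0 (inj_eq inj_t) eq_sym.
have lij i j : j != i -> (l i).[t j] = 0.
  by move=> ji; rewrite hornerM horner_prod (bigD1 j) //= hornerXsubC subrr mul0r mulr0.
pose c i := (f (t i) - p.[t i]) / (l i).[t i].
have ldvd v : v %| w -> v %| p - (p + \sum_i c i *: l i).
  move=> vw; rewrite opprD addNKr dvdpNr.
  apply: (big_ind (fun s : {poly R} => v %| s)) => [|x y|i _].
  - exact: dvdp0.
  - exact: dvdp_add.
  - by rewrite -mul_polyC dvdp_mull // dvdp_mulr.
exists (p + \sum_i c i *: l i).
  by apply: agrees_congr fp => //; apply: ldvd; [rewrite dvdp_mulr | rewrite dvdp_mull].
move=> i; rewrite hornerD horner_sum (bigD1 i) //= big1 ?addr0 => [|j ji].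
  by rewrite hornerZ divfK // addrC subrK.
by rewrite hornerZ lij ?mulr0 // eq_sym.
Qed.
End AgreesExistence.

(** * Smoothness of the right-hand side along a polynomial curve *)

Section ChainRule.
Context {R : realType} {d : nat}.
Variables (a b : R) (U : 'cV[{poly R}]_d).
Hypothesis ab : a < b.
Let strip : set (R * 'cV[R]_d) := `[a, b] `*` [set: 'cV[R]_d].
Let gamma (t : R) : R * 'cV[R]_d := (t, evalv U t).

Lemma evalv_derivable x : derivable (evalv U) x 1.
Proof.
apply/derivable_mxP => i j; rewrite (_ : (fun _ => _) = horner (U i 0)).
  exact: derivable_horner.
by apply/funext => t; rewrite mxE.
Qed.

Lemma evalv_derive x : 'D_1 (evalv U) x = evalv (derivv 1 U) x.
Proof.
rewrite (derive_mx (@evalv_derivable x)); apply/matrixP => i j.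
rewrite !mxE (_ : (fun _ => _) = horner (U i 0)); last first.
  by apply/funext => t; rewrite mxE.
by rewrite -derive1E -derivE.
Qed.

Let gamma_diff x : differentiable gamma x.
Proof.
by apply: differentiable_pair => //; apply/derivable1_diffP/evalv_derivable.
Qed.

Let gamma_continuous x : {for x, continuous gamma}.
Proof. exact/differentiable_continuous. Qed.

(* Continuity within the closed strip suffices, since the filter F stays in
   [a, b]; nothing is known about h outside the strip. *)
Let strip_cvg (h : R * 'cV[R]_d -> 'cV[R]_d) j (F : set_system R) (x : R) :
  {within strip, continuous h} -> Filter F -> F --> x ->
  (\forall t \near F, t \in `[a, b]%R) -> x \in `[a, b]%R ->
  h (gamma t) j 0 @[t --> F] --> h (gamma x) j 0.
Proof.
move=> hc FF Fx Fab xab.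
apply: (@cvg_comp _ _ _ (fun t => h (gamma t)) (fun M : 'cV[R]_d => M j 0) _
  (nbhs (h (gamma x)))); last first.
  exact: coord_continuous.
have : h @ within strip (nbhs (gamma x)) --> h (gamma x).
  by move/subspace_continuousP : hc; apply; split.
apply: cvg_comp => A.
rewrite /within /= => gA.
have : \forall t \near x, strip (gamma t) -> A (gamma t) := gamma_continuous gA.
move=> /Fx; rewrite /=; apply: filterS2 Fab => t tab; apply.
by split.
Qed.

(** The derivative of h(t, U(t)) is a combination of directional derivatives
    of h along the same curve, with polynomial coefficients: (1, U'(t)) is
    decomposed on the basis so that the directions do not depend on t.  Each
    of these directional derivatives is smooth to one order less. *)
Lemma Cm_strip_agrees m (h : R * 'cV[R]_d -> 'cV[R]_d) j :
  Cm_strip a b m h -> exists p, agrees a b m (fun t => h (t, evalv U t) j 0) p.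
Proof.
have ain : a \in `[a, b]%R by rewrite in_itv /= lexx ltW.
have bin : b \in `[a, b]%R by rewrite in_itv /= lexx ltW.
have ends (g : R * 'cV[R]_d -> 'cV[R]_d) : {within strip, continuous g} ->
    (g (gamma t) j 0 @[t --> a^'+] --> g (gamma a) j 0) /\
    (g (gamma t) j 0 @[t --> b^'-] --> g (gamma b) j 0).
  move=> gc; split.
    apply: strip_cvg => //; first exact: cvg_at_right_filter (@cvg_id _ _).
    near=> t; rewrite in_itv; apply/andP; split; apply: ltW; near: t.
      exact: nbhs_right_gt.
    exact: nbhs_right_lt.
  apply: strip_cvg => //; first exact: cvg_at_left_filter (@cvg_id _ _).
  near=> t; rewrite in_itv; apply/andP; split; apply: ltW; near: t.
    exact: nbhs_left_gt.
  exact: nbhs_left_lt.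
(* For m = 0, the line through the two endpoint values *)
elim: m h => [|m IH] h [hc hm].
  have [ca cb] := ends h hc.
  pose u := h (gamma a) j 0; pose v := h (gamma b) j 0.
  exists (u%:P + ((v - u) / (b - a)) *: ('X - a%:P)).
  have ba0 : b - a != 0 by rewrite subr_eq0 gt_eqF.
  split => //; rewrite hornerD hornerC hornerZ hornerXsubC.
    by rewrite subrr mulr0 addr0.
  by rewrite divfK // addrC subrK.
have [ca cb] := ends h hc; case: hm => hd hD.
have gin y : a < y < b -> (`]a, b[ `*` [set: 'cV[R]_d]) (gamma y).
  by move=> yab; split => //=; rewrite in_itv.
have hgd y : a < y < b -> differentiable (h \o gamma) y.
  by move=> yab; apply: differentiable_comp => //; apply: hd; exact: gin.
have hgjd y : a < y < b -> derivable (fun t => h (gamma t) j 0) y 1.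
  move=> /hgd /derivable1_diffP hgy.
  by have /derivable_mxP/(_ j 0) := hgy.
have [h0 h0C h0D] := hD (1, 0).
have /fin_all_exists2[hi hiC hiD] : forall i : 'I_d, exists2 g,
    Cm_strip a b m g & forall z, (`]a, b[ `*` [set: 'cV[R]_d]) z ->
    'D_((0 : R), (delta_mx i 0 : 'cV[R]_d)) h z = g z by move=> i; exact: hD.
have [p0 p0P] := IH h0 h0C.
have /fin_all_exists[ps psP] : forall i, exists p,
  agrees a b m (fun t => hi i (t, evalv U t) j 0) p by move=> i; exact: IH.
have dchain y : a < y < b -> derive1 (fun t => h (gamma t) j 0) y =
    h0 (gamma y) j 0 + \sum_i (U i 0)^`().[y] * hi i (gamma y) j 0.
  move=> yab.
  have -> : derive1 (fun t => h (gamma t) j 0) y = ('D_1 (h \o gamma) y) j 0.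
    by rewrite derive1E derive_mx ?mxE //; apply/derivable1_diffP/hgd.
  have dh : differentiable h (gamma y) by apply: hd; exact: gin.
  rewrite deriveE; last exact: hgd.
  rewrite diff_comp //=.
  have -> : 'd gamma y 1 =
      (1, 0) + \sum_i (U i 0)^`().[y] *: (0, delta_mx i 0) :> R * 'cV[R]_d.
    rewrite diff_pair //; last exact/derivable1_diffP/evalv_derivable.
    rewrite -!deriveE //; last exact/derivable1_diffP/evalv_derivable.
    rewrite evalv_derive derive_id.
    apply: injective_projections => /=.
      rewrite (big_morph (@fst R 'cV[R]_d) (id1 := 0) (op1 := +%R)) //=.
      by rewrite big1 ?addr0 // => i _; rewrite scaler0.
    rewrite (big_morph (@snd R 'cV[R]_d) (id1 := 0) (op1 := +%R)) //= add0r.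
    apply/matrixP => i k; rewrite ord1 !mxE summxE (bigD1 i) //=.
    rewrite big1 ?addr0 => [|n ni]; rewrite !mxE.
      by rewrite !eqxx mulr1.
    by rewrite eq_sym (negPf ni) mulr0.
  rewrite linearD linear_sum /=.
  rewrite -deriveE // h0D; last exact: gin.
  rewrite mxE summxE; congr (_ + _); apply: eq_bigr => i _.
  by rewrite linearZ /= mxE -deriveE // hiD //; exact: gin.
apply: (agrees_primitive ab ca cb hgjd).
apply: agrees_eq (agreesD ab p0P (agrees_sum ab (fun i =>
  agreesM ab (agrees_horner a b m (U i 0)^`()) (psP i)))) => // y yab.
by rewrite dchain.
Unshelve. all: by end_near.
Qed.
End ChainRule.

(** * Hermite interpolation as reduction modulo the nodal polynomial *)

Section HermiteData.
Context {R : realType}.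
Implicit Types (p q H : {poly R}) (f : R -> R) (a b c : R).

Lemma endpoint_dvdP (K1 K2 : nat) q :
  (forall i, (i < K1)%N -> (q^`(i)).[-1] = 0) /\
  (forall i, (i < K2)%N -> (q^`(i)).[1] = 0)
  <-> ('X - (-1)%:P) ^+ K1 * ('X - 1%:P) ^+ K2 %| q.
Proof.
have N11 : -1 != 1 :> R by apply/eqP; lra.
rewrite Gauss_dvdp; last first.
  by apply/coprimep_expl/coprimep_expr; rewrite coprimep_XsubC root_XsubC eq_sym.
split=> [[/dvdp_derivnP-> /dvdp_derivnP->] //|].
by case/andP=> /dvdp_derivnP ? /dvdp_derivnP.
Qed.

(** The three groups of conditions are divisibilities by the three pairwise
    coprime factors of the nodal polynomial. *)
Lemma nodal_poly_dvdP (K1 K2 m : nat) (nd : 'I_m -> R) q :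
  injective nd -> (forall i, -1 < nd i < 1) ->
  [/\ forall i, (i < K1)%N -> (q^`(i)).[-1] = 0,
      forall i, (i < K2)%N -> (q^`(i)).[1] = 0 & forall i, q.[nd i] = 0]
  <-> nodal_poly K1 K2 nd %| q.
Proof.
move=> inj_nd nd_in; rewrite /nodal_poly.
have copnd c K : (forall i, nd i != c) ->
    coprimep (('X - c%:P) ^+ K) (\prod_i ('X - (nd i)%:P)).
  move=> ndc; apply/coprimep_expl; rewrite coprimep_sym.
  rewrite coprimep_XsubC /root horner_prod; apply/prodf_neq0 => i _.
  by rewrite hornerXsubC subr_eq0 eq_sym.
have ndN i : nd i != -1 by rewrite gt_eqF //; case/andP: (nd_in i).
have nd1 i : nd i != 1 by rewrite lt_eqF //; case/andP: (nd_in i).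
rewrite Gauss_dvdp; last by rewrite coprimepMl !copnd.
have -> : (\prod_i ('X - (nd i)%:P) %| q) = [forall i, root q (nd i)].
  have -> : \prod_i ('X - (nd i)%:P) = \prod_(z <- codom nd) ('X - z%:P).
    by rewrite big_image.
  apply/idP/forallP => [/dvdpP[s ->] i|rq].
    by rewrite rootM root_prod_XsubC codom_f orbT.
  apply: uniq_roots_dvdp; first by apply/allP => z /codomP[i ->].
  by rewrite uniq_rootsE map_inj_uniq // enum_uniq.
split=> [[q1 q2 q3]|/andP[/endpoint_dvdP[q1 q2] /forallP q3]].
  apply/andP; split; first exact/endpoint_dvdP.
  by apply/forallP => i; rewrite /root q3.
by split => // i; apply/eqP/q3.
Qed.

(** The Hermite conditions on p amount to the divisibility of p - H by the
    nodal polynomial, whose degree is r + 1.  This gives at once existence and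
    uniqueness of the interpolant. *)
Lemma ref_interp_agrees (r k : nat) (nd : 'I_(r - k) -> R) f H :
  (k <= r)%N -> injective nd -> (forall i, -1 < nd i < 1) ->
  agrees (-1) 1 k./2 f H -> (forall i, H.[nd i] = f (nd i)) ->
  ref_interp nd f = H %% nodal_poly (uphalf k) (k./2).+1 nd.
Proof.
move=> le_kr inj_nd nd_in fH Hnd; set W := nodal_poly _ _ _.
have szW : size W = r.+2 by rewrite size_nodal_poly; lia.
have W0 : W != 0 := nodal_poly_neq0 _ _ _.
have hermiteP p : is_hermite nd f p <-> (size p <= r.+1)%N /\ W %| p - H.
  split=> [[szp pN p1 pnd]|[szp /nodal_poly_dvdP[] // pN p1 pnd]].
    split => //; apply/nodal_poly_dvdP => //; split => i.
    - move=> ik; rewrite derivnB hornerD hornerN pN // (agrees_deriv_right _ fH).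
        by rewrite subrr.
      lia.
    - move=> ik; rewrite derivnB hornerD hornerN p1 // (agrees_deriv_left _ fH) //.
      by rewrite subrr.
    - by rewrite hornerD hornerN pnd Hnd subrr.
  split => // i => [ik|ik|].
  - rewrite (agrees_deriv_right _ fH); last lia.
    by apply/eqP; rewrite -subr_eq0 -hornerN -hornerD -derivnB pN.
  - rewrite (agrees_deriv_left _ fH) //.
    by apply/eqP; rewrite -subr_eq0 -hornerN -hornerD -derivnB p1.
  - by apply/eqP; rewrite -Hnd -subr_eq0 -hornerN -hornerD pnd.
apply: xget_unique => [|p /hermiteP[szp]].
  apply/hermiteP; split; first by rewrite -ltnS -szW ltn_modp.
  by rewrite /dvdp modpD modpN modp_id subrr.
rewrite /dvdp modpD modpN (modp_small (p := p)) ?szW ?ltnS //.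
by rewrite subr_eq0 => /eqP.
Qed.

Lemma to_ref_comp a b : a < b ->
  to_ref a b \Po (((b - a) / 2) *: 'X + ((a + b) / 2)%:P) = 'X.
Proof.
move=> ab; rewrite /to_ref comp_polyZ comp_polyB comp_polyZ comp_polyX comp_polyC.
rewrite [2 *: (_ + _)]scalerDr scalerA -[2 *: _%:P]mul_polyC -polyCM.
rewrite ![2 * (_ / 2)]mulrC !divfK ?pnatr_eq0 // addrK.
by rewrite scalerA mulVf ?scale1r // subr_eq0 gt_eqF.
Qed.

Lemma size_to_ref a b : a < b -> size (to_ref a b) = 2%N.
Proof.
move=> ab; have ba0 : b - a != 0 by rewrite subr_eq0 gt_eqF.
rewrite /to_ref size_scale ?invr_eq0 // size_polyDl.
  by rewrite size_scale ?pnatr_eq0 // size_polyX.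
rewrite size_polyN size_scale ?pnatr_eq0 // size_polyX.
by rewrite ltnS size_polyC_leq1.
Qed.

(** The quadrature rule is the functional q |-> int_(-1)^1 (q mod W), applied
    to any polynomial with the relevant data and scaled by half the length of
    the interval. *)
Lemma quad_agrees a b (r k : nat) (nd : 'I_(r - k) -> R) f H :
  a < b -> (k <= r)%N -> injective nd -> (forall i, -1 < nd i < 1) ->
  agrees a b k./2 f H ->
  (forall i, H.[from_ref a b (nd i)] = f (from_ref a b (nd i))) ->
  quad a b nd f = (b - a) / 2 * poly_int (-1) 1
    ((H \Po (((b - a) / 2) *: 'X + ((a + b) / 2)%:P))
       %% nodal_poly (uphalf k) (k./2).+1 nd).
Proof.
move=> ab le_kr inj_nd nd_in fH Hnd.
set c := (b - a) / 2; set d := (a + b) / 2.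
have c0 : 0 < c by rewrite /c; lra.
have N11 : -1 < 1 :> R by lra.
have frE s : from_ref a b s = c * s + d by rewrite /from_ref /c /d; field.
have aE : a = c * -1 + d by rewrite /c /d; field.
have bE : b = c * 1 + d by rewrite /c /d; field.
rewrite /quad /interp.
rewrite (_ : (fun s => f (from_ref a b s)) = (fun s => f (c * s + d))); last first.
  by apply/funext => s; rewrite frE.
rewrite (@ref_interp_agrees _ _ _ _ (H \Po (c *: 'X + d%:P))) //.
- set P := _ %% _.
  rewrite (_ : poly_int a b _ =
               poly_int (c * -1 + d) (c * 1 + d) (P \Po to_ref a b)).
    rewrite poly_int_comp_affine //.
    rewrite -comp_polyA; congr (_ * poly_int _ _ _).
    rewrite -[RHS]comp_polyXr; congr (_ \Po _).
    exact: to_ref_comp.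
  by rewrite -aE -bE.
- by apply: agrees_comp_affine => //; rewrite -aE -bE.
- by move=> i; rewrite horner_comp horner_affine -frE.
Qed.
End HermiteData.

(** * Derivatives of vector-valued functions *)

Section VectorDerivatives.
Context {R : realType} {d : nat} (a b : R) (lt_ab : a < b).

Lemma cvg_col (T : Type) (F : set_system T) (G : T -> 'cV[R]_d) (v : 'cV[R]_d) :
  Filter F -> (forall j, G x j 0 @[x --> F] --> v j 0) -> G @ F --> v.
Proof.
move=> FF Gv; apply/cvgrPdist_le => /= e e0; near=> x.
rewrite /Num.Def.normr /= mx_normrE (bigmax_le _ (ltW e0)) //= => -[i j] _.
rewrite !mxE ord1 /=; move: i; near: x; apply: filter_forall => i.
exact: ((cvgrPdist_le _ _).1 (Gv i)).
Unshelve. all: by end_near. Qed.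

(** The derivative of a column-valued function may be taken componentwise only
    where all components are differentiable, which [agrees] ensures up to
    order m. *)
Lemma derive1n_col m i (G : R -> 'cV[R]_d) (H : 'I_d -> {poly R}) y j :
  (forall j, agrees a b m (fun t => G t j 0) (H j)) -> (i <= m)%N ->
  a < y < b -> (derive1n i G y) j 0 = derive1n i (fun t => G t j 0) y.
Proof.
move=> GH; elim: i y j => [|i IH] y j im yab; first by [].
have near_y :
    \forall t \near y, derive1n i G t = \col_j derive1n i (fun t => G t j 0) t.
  have : y \in `]a, b[%R by rewrite in_itv.
  move/near_in_itvoo; apply: filterS => t; rewrite in_itv => tab.
  by apply/matrixP => n q; rewrite ord1 mxE IH // ltnW.
rewrite !derive1nS !derive1E (near_eq_derive _ near_y) derive_mx.
  rewrite mxE; congr ('D_1 _ y); apply/funext => t; by rewrite mxE.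
apply/derivable_mxP => n q.
rewrite (_ : (fun _ => _) = derive1n i (fun t => G t n 0)); last first.
  by apply/funext => t; rewrite mxE.
exact: (agrees_derivable im (GH n) yab).
Qed.

Lemma deriv_left_col m i (G : R -> 'cV[R]_d) (H : 'I_d -> {poly R}) :
  (forall j, agrees a b m (fun t => G t j 0) (H j)) -> (i <= m)%N ->
  deriv_left i G b = \col_j (derivn i (H j)).[b].
Proof.
move=> GH im; apply: cvg_lim => //; apply: cvg_col => j; rewrite mxE.
have [_] := agrees_cvg im (GH j); apply: cvg_trans; apply: near_eq_cvg.
near=> y; rewrite (derive1n_col j GH) //; apply/andP; split; near: y.
  exact: nbhs_left_gt.
exact: nbhs_left_lt.
Unshelve. all: by end_near. Qed.

Lemma deriv_right_col m i (G : R -> 'cV[R]_d) (H : 'I_d -> {poly R}) :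
  (forall j, agrees a b m (fun t => G t j 0) (H j)) -> (i <= m)%N ->
  deriv_right i G a = \col_j (derivn i (H j)).[a].
Proof.
move=> GH im; apply: cvg_lim => //; apply: cvg_col => j; rewrite mxE.
have [+ _] := agrees_cvg im (GH j); apply: cvg_trans; apply: near_eq_cvg.
near=> y; rewrite (derive1n_col j GH) //; apply/andP; split; near: y.
  exact: nbhs_right_gt.
exact: nbhs_right_lt.
Unshelve. all: by end_near. Qed.

Definition mulmx_deriv (M : 'M[R]_d) (U : 'cV[{poly R}]_d) j : {poly R} :=
  \sum_i M j i *: (U i 0)^`().

Lemma mulmx_derivE (M : 'M[R]_d) (U : 'cV[{poly R}]_d) i x j :
  (M *m evalv (derivv i.+1 U) x) j 0 = ((mulmx_deriv M U j)^`(i)).[x].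
Proof.
rewrite mxE /mulmx_deriv.
have d0 : derivn i (0 : {poly R}) = 0 by rewrite -polyC0 derivnC if_same.
rewrite (big_morph _ (derivnD i) d0) horner_sum; apply: eq_bigr => n _.
by rewrite derivnZ hornerZ !mxE derivSn.
Qed.

Lemma derivn_comp_affine i (c e x : R) (p : {poly R}) :
  ((p \Po (c *: 'X + e%:P))^`(i)).[x] = c ^+ i * (p^`(i)).[c * x + e].
Proof.
elim: i p => [|i IH] p; first by rewrite mul1r horner_comp horner_affine.
rewrite !derivSn deriv_comp derivD derivZ derivX derivC addr0.
have -> : (p^`() \Po (c *: 'X + e%:P)) * (c *: 1) = c *: (p^`() \Po (c *: 'X + e%:P)).
  by rewrite -scalerAr mulr1.
by rewrite derivnZ hornerZ IH exprS mulrA.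
Qed.
End VectorDerivatives.

(** * Equivalence with collocation *)

Unset Implicit Arguments.

Theorem theorem4p1 (R : realType) (d : nat) (M : 'M[R]_d)
    (F : R -> 'cV[R]_d -> 'cV[R]_d) (tn1 tn : R) (r k l : nat)
    (nd : 'I_(r - k) -> R) (u0 : 'cV[R]_d) (U : 'cV[{poly R}]_d)
    (regM : M \in unitmx) (lt_t : tn1 < tn)
    (smoothF : Cm_strip tn1 tn k./2 (fun z => F z.1 z.2))
    (lipF : lipschitz_snd tn1 tn F)
    (le_kr : (k <= r)%N) (l_bounds : (1 <= l <= k + 2)%N)
    (nodes : jacobi_nodes nd)
    (degU : is_polyvec (r + 2) U) :
  vtd_problem M F tn1 tn l nd u0 U <->
  collocation_problem M F tn1 tn nd u0 U.
Proof.
have [inj_nd nd_in [pj pj_jacobi pj_root]] := nodes.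
pose c := (tn - tn1) / 2; pose e := (tn1 + tn) / 2.
pose aff : {poly R} := c *: 'X + e%:P.
have N11 : -1 < 1 :> R by lra.
have c0 : 0 < c by rewrite /c; lra.
have cn0 : c != 0 by rewrite gt_eqF.
have frE s : from_ref tn1 tn s = c * s + e by rewrite /from_ref /c /e; field.
have aE : c * -1 + e = tn1 by rewrite /c /e; field.
have bE : c * 1 + e = tn by rewrite /c /e; field.
pose node i := from_ref tn1 tn (nd i).
have inj_node : injective node.
  by move=> i j; rewrite /node !frE => /addIr /(mulfI cn0) /inj_nd.
have node_in i : tn1 < node i < tn.
  by rewrite /node frE -aE -bE !ltrD2r !ltr_pM2l.
pose G t := F t (evalv U t).
have /fin_all_exists2[H GH Hnd] : forall j : 'I_d, exists2 p,
    agrees tn1 tn k./2 (fun t => G t j 0) p &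
    forall i, p.[node i] = G (node i) j 0.
  move=> j; have [p Gp] := Cm_strip_agrees U lt_t j smoothF.
  exact: (agrees_interpolate lt_t inj_node node_in Gp).
(* H matches the data of F(t, U(t)), so E represents the defect M U' - F,
   transported to [-1, 1]. *)
pose mu := mulmx_deriv M U.
pose E j := (mu j - H j) \Po aff.
pose W := nodal_poly (uphalf k) (k./2).+1 nd.
have orthW := nodal_poly_orthogonal inj_nd pj_jacobi pj_root.
have at_b i : (i <= k./2)%N ->
  (M *m evalv (derivv i.+1 U) tn = deriv_left i G tn <->
   forall j, ((E j)^`(i)).[1] = 0).
  move=> ik; rewrite (deriv_left_col lt_t GH ik); split=> [eqb j|E0].
    have /(congr1 (fun v : 'cV[R]_d => v j 0)) := eqb.
    rewrite mulmx_derivE mxE => eqj.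
    by rewrite derivn_comp_affine bE derivnB hornerD hornerN eqj subrr mulr0.
  apply/matrixP => j q; rewrite ord1 mulmx_derivE mxE; apply/eqP.
  move: (E0 j) => /eqP; rewrite derivn_comp_affine bE derivnB hornerD hornerN.
  by rewrite mulf_eq0 expf_eq0 (negPf cn0) andbF subr_eq0.
have at_a i : (i <= k./2)%N ->
  (M *m evalv (derivv i.+1 U) tn1 = deriv_right i G tn1 <->
   forall j, ((E j)^`(i)).[-1] = 0).
  move=> ik; rewrite (deriv_right_col lt_t GH ik); split=> [eqb j|E0].
    have /(congr1 (fun v : 'cV[R]_d => v j 0)) := eqb.
    rewrite mulmx_derivE mxE => eqj.
    by rewrite derivn_comp_affine aE derivnB hornerD hornerN eqj subrr mulr0.
  apply/matrixP => j q; rewrite ord1 mulmx_derivE mxE; apply/eqP.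
  move: (E0 j) => /eqP; rewrite derivn_comp_affine aE derivnB hornerD hornerN.
  by rewrite mulf_eq0 expf_eq0 (negPf cn0) andbF subr_eq0.
have at_node i :
  (M *m evalv (derivv 1 U) (node i) = G (node i) <-> forall j, (E j).[nd i] = 0).
  have EE j : (E j).[nd i] = (mu j).[node i] - G (node i) j 0.
    by rewrite horner_comp horner_affine -frE hornerD hornerN -/(node i) Hnd.
  split=> [eqn j|E0].
    by rewrite EE -eqn mulmx_derivE derivn0 subrr.
  apply/matrixP => j q; rewrite ord1 mulmx_derivE derivn0; apply/eqP.
  by rewrite -subr_eq0 -EE E0.
have collocE : collocation_problem M F tn1 tn nd u0 U <->
    evalv U tn1 = u0 /\ forall j, W %| E j.
  split=> [[U0 colb cola coln]|[U0 WE]].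
    split => // j; apply/nodal_poly_dvdP => //; split => i.
    - move=> ik; have k0 : (0 < k)%N by lia.
      by move/at_a: (cola k0 i ltac:(lia)); apply; lia.
    - by move=> ik; move/at_b: (colb i ik); apply.
    - by move/at_node: (coln i); apply.
  have {}WE j : [/\ forall i, (i < uphalf k)%N -> ((E j)^`(i)).[-1] = 0,
      forall i, (i < (k./2).+1)%N -> ((E j)^`(i)).[1] = 0
    & forall i, (E j).[nd i] = 0] by apply/nodal_poly_dvdP.
  split => // [i ik|k0 i ik|i].
  - by apply/at_b => // j; have [_ + _] := WE j; apply.
  - by apply/at_a => [|j]; [lia | have [+ _ _] := WE j; apply; lia].
  - by apply/at_node => j; have [_ _] := WE j; apply.
have quadE (phi : 'cV[{poly R}]_d) :
  quad tn1 tn nd (fun t => dotv (M *m evalv (derivv 1 U) t) (evalv phi t)) =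
  quad tn1 tn nd (fun t => dotv (F t (evalv U t)) (evalv phi t)) <->
  poly_int (-1) 1 ((\sum_j E j * (phi j 0 \Po aff)) %% W) = 0.
  have muphi : agrees tn1 tn k./2
      (fun t => dotv (M *m evalv (derivv 1 U) t) (evalv phi t))
      (\sum_j mu j * phi j 0).
    apply: agrees_eq (agrees_horner _ _ _ _) => // t _.
    rewrite horner_sum; apply: eq_bigr => j _.
    by rewrite hornerM mulmx_derivE derivn0 mxE.
  have Hphi : agrees tn1 tn k./2
      (fun t => dotv (F t (evalv U t)) (evalv phi t))
      (\sum_j H j * phi j 0).
    apply: agrees_eq (agrees_sum lt_t (fun j =>
      agreesM lt_t (GH j) (agrees_horner _ _ _ (phi j 0)))) => // t _.
    by apply: eq_bigr => j _; rewrite mxE.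
  rewrite (quad_agrees lt_t le_kr inj_nd nd_in muphi); last first.
    move=> i; rewrite horner_sum; apply: eq_bigr => j _.
    by rewrite hornerM mulmx_derivE derivn0 mxE.
  rewrite (quad_agrees lt_t le_kr inj_nd nd_in Hphi); last first.
    move=> i; rewrite horner_sum; apply: eq_bigr => j _.
    by rewrite hornerM Hnd mxE.
  have -> : \sum_j E j * (phi j 0 \Po aff) =
      ((\sum_j mu j * phi j 0) \Po aff) - ((\sum_j H j * phi j 0) \Po aff).
    rewrite -comp_polyB -sumrB raddf_sum /=; apply: eq_bigr => j _.
    by rewrite -mulrBl comp_polyM.
  rewrite modpD modpN poly_intB //.
  split=> [/(mulfI cn0) ->|/eqP]; first by rewrite subrr.
  by rewrite subr_eq0 => /eqP ->.
rewrite collocE; split=> [[U0 vtdb vtda vtdq]|[U0 WE]]; split => //.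
- move=> j.
  apply: (nodal_poly_dvd_test orthW (L1 := (l.-1)./2) (L2 := l./2)); try lia.
    apply/endpoint_dvdP; split => i il.
      have l3 : (3 <= l)%N by lia.
      by move/at_a: (vtda l3 i il); apply; lia.
    have l2 : (2 <= l)%N by lia.
    by move/at_b: (vtdb l2 i il); apply; lia.
  (* Test with q in the j-th component only. *)
  move=> q szq; pose phi : 'cV[{poly R}]_d :=
    \col_i (if i == j then q \Po to_ref tn1 tn else 0).
  have phi_comp i : phi i 0 \Po aff = if i == j then q else 0.
    rewrite mxE; case: eqP => _; last exact: comp_polyC.
    by rewrite -comp_polyA to_ref_comp // comp_polyXr.
  have szphi : is_polyvec (r + 2 - l) phi.
    have degE : (uphalf k - l.-1./2 + (k./2.+1 - l./2) + (r - k) = r + 2 - l)%N.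
      lia.
    move=> i; rewrite mxE; case: eqP => _; last by rewrite size_poly0.
    by rewrite size_comp_poly2 ?size_to_ref // -degE.
  have /quadE := vtdq phi szphi; rewrite (bigD1 j) //= big1 ?addr0 => [|i ij].
    by rewrite phi_comp eqxx.
  by rewrite phi_comp (negPf ij) mulr0.
- move=> l2 i il; apply/at_b => [|j]; first lia.
  have /nodal_poly_dvdP[] // := WE j.
  by move=> _ + _; apply; lia.
- move=> l3 i il; apply/at_a => [|j]; first lia.
  have /nodal_poly_dvdP[] // := WE j.
  by move=> + _ _; apply; lia.
- move=> phi _; apply/quadE.
  have /eqP-> : W %| \sum_j E j * (phi j 0 \Po aff).
    apply: (big_ind (fun s : {poly R} => W %| s)) => [|x y|j _].
    - exact: dvdp0.
    - exact: dvdp_add.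
    - by rewrite dvdp_mulr.
  by rewrite poly_int0 //; lra.
Qed.
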